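(* For every positive integer $\ell$ and $|q|<1$, $$\frac{(-q;q)_\infty}{(q;q)_\infty}\sum_{j=-\ell+1}^{\ell}(-1)^jq^{j^2}=1+(-1)^{\ell-1}\sum_{n=0}^\infty\frac{(-q)_{n+\ell}\,q^{\ell n+\frac{n(n+1)}{2}+\ell^2}(1-q^\ell)}{(q)_n(q)_{n+2\ell}(1-q^{n+\ell})}.$$
   Context: $(a)_n=(a;q)_n=\prod_{m=0}^{n-1}(1-aq^m)$ with $(a;q)_0=1$, and $(a;q)_\infty=\prod_{m\ge0}(1-aq^m)$. *)

(* Defs.v *)
From HB Require Import structures.
From mathcomp Require Import all_boot all_order all_algebra.
From mathcomp Require Import all_classical all_reals all_analysis.
From mathcomp Require Import complex.

Set Implicit Arguments.
Unset Strict Implicit.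
Unset Printing Implicit Defensive.

Import Order.TTheory GRing.Theory Num.Theory.
Import numFieldNormedType.Exports.

Local Open Scope classical_set_scope.
Local Open Scope ring_scope.

(* The library puts no topology on R[i]; we transport the norm topology that
   every numFieldType K carries through its alias K^o. *)
HB.instance Definition _ (R : rcfType) := NormedModule.copy R[i] R[i]^o.

Section QPochhammer.
Variable K : numFieldType.

Definition qpoch (a q : K) (n : nat) : K := \prod_(m < n) (1 - a * q ^+ m).

(* A total function: meaningful when the partial products converge. *)
Definition qpoch_oo (a q : K) : K := limn (qpoch a q).

End QPochhammer.

(* Main.v *)
Require Import Defs.
From mathcomp Require Import all_boot all_order all_algebra.
From mathcomp Require Import all_classical all_reals all_analysis.
From mathcomp Require Import complex.
From mathcomp Require Import ring zify.

(** Write P for (-q)_oo / (q)_oo, S_l for the theta sum over -l < j <= l, and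
    T_l for the series on the right. Passing from l to l + 1 adds to S_l the two
    terms j = -l and j = l + 1, that is (-1)^l q^(l^2) (1 - q^(2l+1)). So the
    identity for all l follows by induction once
      T_l + T_(l+1) = q^(l^2) (1 - q^(2l+1)) P,
    the start being the case l = 0 of the same relation with T_0 read as 1,
    because (1 - q^l) / (1 - q^(n+l)) should count as 1 at l = n = 0.

    To prove this relation, shift the second series by one index. The summands
    of T_l at n + 1 and of T_(l+1) at n then share all their factors up to the
    elementary identity, with m = n + 1,
      (1 - q^l) (1 - q^(m+2l+1)) + q^l (1 - q^(l+1)) (1 - q^m)
        = (1 - q^(m+l)) (1 - q^(2l+1)),
    which also cancels the denominator 1 - q^(m+l) ([tail_term_glue]). What is
    left is a 1phi1 series with a = b = -q^(l+1), and [phi11_sum] evaluates it: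
      sum_n (a)_n (-b)^n q^(n(n-1)/2) / ((q)_n (ab)_n) = (b)_oo / (ab)_oo.

    The 1phi1 sum satisfies (1 - ab) phi(b) = (1 - b) phi(bq), because the
    difference of the summands telescopes ([phi11_term_rec]). Iterating gives
    (ab)_N phi(b) = (b)_N phi(b q^N), and phi(b q^N) tends to 1
    ([phi11_lim1]).

    The convergence statements all come down to domination by a geometric
    sequence: [geo_dom_cvg_series] for series, and [geo_dom_prod] for products,
    applied both to (a)_n and to 1 / (a)_n, so that the limit of (a)_n is seen
    to be nonzero. *)

Set Implicit Arguments.
Unset Strict Implicit.
Unset Printing Implicit Defensive.

Import Order.TTheory GRing.Theory Num.Theory.
Import numFieldNormedType.Exports.
Local Open Scope classical_set_scope.
Local Open Scope ring_scope.
Local Open Scope complex_scope.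

(** * Limits in R[i] and geometric domination *)

(** The limit rules for R[i] name its normed module structure explicitly: its
    topology is transported from R[i]^o, and inferring the structure would make
    unification unfold the complex operations. *)
Lemma cvgc_lim (R : realType) (u : nat -> R[i]) (a : R[i]) :
  u @ \oo --> a -> limn u = a.
Proof. exact: (@cvg_lim R[i] (@norm_hausdorff R[i] (R[i] : normedModType R[i]))). Qed.

Lemma cvgcD (R : realType) (u v : nat -> R[i]) (a b : R[i]) :
  u @ \oo --> a -> v @ \oo --> b -> (fun n => u n + v n) @ \oo --> a + b.
Proof. exact: (@cvgD _ (R[i] : normedModType R[i])). Qed.

Lemma cvgcB (R : realType) (u v : nat -> R[i]) (a b : R[i]) :
  u @ \oo --> a -> v @ \oo --> b -> (fun n => u n - v n) @ \oo --> a - b.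
Proof. exact: (@cvgB _ (R[i] : normedModType R[i])). Qed.

(** The product rule at an abstract field, where the topology of the ring and
    that of the module over itself are found to agree without unfolding. *)
Lemma numField_cvgM (K : numFieldType) (u v : nat -> K) (a b : K) :
  u @ \oo --> a -> v @ \oo --> b -> (fun n => u n * v n) @ \oo --> a * b.
Proof. by move=> ua vb; exact: cvgM. Qed.

Lemma cvgcM (R : realType) (u v : nat -> R[i]) (a b : R[i]) :
  u @ \oo --> a -> v @ \oo --> b -> (fun n => u n * v n) @ \oo --> a * b.
Proof. exact: (@numField_cvgM R[i]). Qed.

Lemma cvgc_cst (R : realType) (c : R[i]) : (fun _ : nat => c) @ \oo --> c.
Proof. exact: cvg_cst. Qed.
Arguments cvgc_cst {R} c.

Lemma cvgcMl (R : realType) (c : R[i]) (u : nat -> R[i]) (a : R[i]) :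
  u @ \oo --> a -> (fun n => c * u n) @ \oo --> c * a.
Proof. exact: (@cvgcM R (fun=> c) u c a (cvgc_cst c)). Qed.
Arguments cvgcMl {R} c {u a}.

Lemma cvgcS (R : realType) (u : nat -> R[i]) (a : R[i]) :
  u @ \oo --> a -> (fun n => u n.+1) @ \oo --> a.
Proof. by rewrite -cvg_shiftS. Qed.

Lemma cvgc_unique (R : realType) (u : nat -> R[i]) (a b : R[i]) :
  u @ \oo --> a -> u @ \oo --> b -> a = b.
Proof. by move=> /cvgc_lim <- /cvgc_lim. Qed.

Lemma cvg_real_complex (R : realType) (u : nat -> R) (x : R) :
  u @ \oo --> x -> (fun n => (u n)%:C) @ \oo --> (x%:C : R[i]).
Proof.
move=> /cvgrPdist_lt ux; apply/cvgrPdist_lt => e e0.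
have eR : e = (complex.Re e)%:C by rewrite RRe_real // gtr0_real.
move: e0; rewrite eR ltcR => e0.
near=> n.
rewrite -rmorphB normc_def /= expr0n /= addr0 sqrtr_sqr ltcR.
by near: n; exact: ux.
Unshelve. all: by end_near. Qed.

(** The order of R[i] is partial, so the comparison of limits valid in a real
    field does not apply; but two real elements of R[i] are comparable, and if
    the norm of the limit exceeded C, so would that of some u n. *)
Lemma cvgc_norm_le (R : realType) (u : nat -> R[i]) (a : R[i]) (C : R) :
  u @ \oo --> a -> (forall n, `|u n| <= C%:C) -> `|a| <= C%:C.
Proof.
move=> /cvgrPdist_lt ua uC.
have [//|aC] := real_leP (normr_real a) (ger0_real (le_trans (normr_ge0 _) (uC 0))).
have /ua [N _ /(_ N (leqnn N)) /= aN] : 0 < `|a| - C%:C by rewrite subr_gt0.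
have : `|a| < `|a|.
  rewrite -{1}(subrK (u N) a); apply: le_lt_trans (ler_normD _ _) _.
  by rewrite -[X in _ < X](subrK C%:C); apply: ltr_leD.
by rewrite ltxx.
Qed.

Lemma sum_expr_le (R : realType) (r : R) (n : nat) :
  0 <= r < 1 -> \sum_(i < n) r ^+ i <= (1 - r)^-1.
Proof.
move=> /andP[r0 r1].
have r10 : 0 < 1 - r by rewrite subr_gt0.
rewrite -[leRHS]mul1r ler_pdivlMr // mulrC.
have -> : (1 - r) * \sum_(i < n) r ^+ i = 1 - r ^+ n.
  by rewrite -[LHS]opprK -mulNr opprB -subrX1 opprB.
by rewrite lerBlDr lerDl exprn_ge0.
Qed.

(** Real constants C and r let the bounds be compared and summed in R, where
    the order is total. [geo_dom 1] expresses boundedness. *)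
Definition geo_dom (R : realType) (r : R) (u : nat -> R[i]) :=
  exists C : R, forall n, `|u n| <= (C * r ^+ n)%:C.

Lemma geo_domM (R : realType) (r s : R) (u v : nat -> R[i]) :
  geo_dom r u -> geo_dom s v -> geo_dom (r * s) (fun n => u n * v n).
Proof.
move=> [C uC] [D vD]; exists (C * D) => n.
by rewrite exprMn mulrACA rmorphM normrM ler_pM.
Qed.

(** Completeness is available for R only: a complex series is handled through
    real parts, its imaginary part being minus the real part of 'i times it. *)
Lemma geo_dom_cvg_Re (R : realType) (r : R) (u : nat -> R[i]) :
  0 <= r < 1 -> geo_dom r u -> cvgn (series (fun n => complex.Re (u n))).
Proof.
move=> /andP[r0 r1] [C uC]; apply: normed_cvg.
have cg : cvgn (series (geometric C r)).
  by apply: is_cvg_geometric_series; rewrite ger0_norm.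
apply: series_le_cvg cg => n /=.
- by [].
- by rewrite -ler0c (le_trans (normr_ge0 _) (uC n)).
- by rewrite -lecR (le_trans (normc_ge_Re _) (uC n)).
Qed.

Lemma geo_dom_cvg_series (R : realType) (r : R) (u : nat -> R[i]) :
  0 <= r < 1 -> geo_dom r u -> cvgn (series u).
Proof.
move=> r01 ru.
have rui : geo_dom r (fun n => u n * 'i%C).
  have [C uC] := ru; exists C => n.
  by rewrite normrM [X in _ * X](_ : _ = 1) ?mulr1 // normc_def /= expr0n expr1n add0r sqrtr1.
have /cvg_real_complex cre := geo_dom_cvg_Re r01 ru.
have /cvg_real_complex cim := geo_dom_cvg_Re r01 rui.
apply: (cvgP (_ : R[i])).
have -> : series u = (fun n => (series (fun n => complex.Re (u n)) n)%:C
   + (- 'i%C) * (series (fun n => complex.Re (u n * 'i%C)) n)%:C).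
  apply/funext => n; rewrite /series /= !rmorph_sum mulr_sumr -big_split /=.
  apply: eq_bigr => i _; rewrite ReiNIm [LHS]complexE.
  by rewrite rmorphN mulrN mulNr opprK.
by apply: cvgcD cre _; apply: cvgcMl cim.
Qed.

Lemma geo_dom_cvg0 (R : realType) (r : R) (u : nat -> R[i]) :
  0 <= r < 1 -> geo_dom r u -> u @ \oo --> (0 : R[i]).
Proof.
move=> r01 /(geo_dom_cvg_series r01) cu.
have := cvgcB (cvgcS cu) cu; rewrite subrr.
have -> // : (fun n => series u n.+1 - series u n) = u.
by apply/funext => n; rewrite seriesS addrK.
Qed.

(** The partial products P n are bounded, by 1 + t <= exp t; hence their
    increments P n * x n are geometrically dominated too. *)
Lemma geo_dom_prod (R : realType) (r : R) (x : nat -> R[i]) :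
  0 <= r < 1 -> geo_dom r x ->
  geo_dom 1 (fun n => \prod_(m < n) (1 + x m))
  /\ cvgn (fun n => \prod_(m < n) (1 + x m)).
Proof.
move=> r01 rx; set P := fun n => _.
have [C xC] := rx.
have C0 : 0 <= C.
  by have := le_trans (normr_ge0 _) (xC 0); rewrite expr0 mulr1 ler0c.
have P1 : geo_dom 1 P.
  exists (expR (C * (1 - r)^-1)) => n; rewrite expr1n mulr1.
  suff : `|P n| <= (expR (C * \sum_(m < n) r ^+ m))%:C.
    move/le_trans; apply; rewrite lecR ler_expR.
    by rewrite ler_wpM2l // sum_expr_le.
  rewrite /P; elim: n => [|n IH].
    by rewrite !big_ord0 mulr0 expR0 normr1.
  rewrite !big_ord_recr /= [C * _]mulrDr expRD rmorphM normrM ler_pM //.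
  apply: le_trans (ler_normD _ _) _; rewrite normr1.
  apply: (@le_trans _ _ (1 + C * r ^+ n)%:C).
    by rewrite rmorphD rmorph1 lerD2l.
  by rewrite lecR expR_ge1Dx.
split => //.
have /(geo_dom_cvg_series r01) cs : geo_dom r (fun n => P n * x n).
  by rewrite -[r]mul1r; exact: geo_domM.
apply: (cvgP (_ : R[i])).
have -> : P = (fun n => 1 + series (fun n => P n * x n) n).
  apply/funext; elim=> [|n IH]; first by rewrite /P /series /= big_geq // big_ord0 addr0.
  by rewrite seriesSr addrA -IH {1}/P big_ord_recr /= mulrDr mulr1.
by apply: cvgcD cs; exact: cvgc_cst.
Qed.

(** * Convergence of q-Pochhammer products *)

Lemma normc_lt1 (R : realType) (z : R[i]) : `|z| < 1 ->
  exists2 r : R, 0 <= r < 1 & `|z| = r%:C.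
Proof.
have zr : `|z| = (complex.Re `|z|)%:C by rewrite RRe_real // normr_real.
move=> z1; exists (complex.Re `|z|) => //.
by rewrite -ler0c -ltcR -zr normr_ge0.
Qed.

Lemma geo_dom_le (R : realType) (r : R) (u v : nat -> R[i]) :
  geo_dom r u -> (forall n, `|v n| <= `|u n|) -> geo_dom r v.
Proof. by move=> [C uC] vu; exists C => n; exact: le_trans (vu n) (uC n). Qed.

Lemma geo_dom_expr (R : realType) (r : R) (q : R[i]) :
  `|q| = r%:C -> geo_dom r (fun n => q ^+ n).
Proof. by move=> qr; exists 1 => n; rewrite mul1r normrX qr rmorphXn. Qed.

Lemma geo_dom_cst (R : realType) (c : R[i]) : geo_dom 1 (fun=> c).
Proof.
exists (complex.Re `|c|) => n.
by rewrite expr1n mulr1 RRe_real // normr_real.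
Qed.

Lemma geo_dom_comp (R : realType) (u : nat -> R[i]) (f : nat -> nat) :
  geo_dom 1 u -> geo_dom 1 (fun n => u (f n)).
Proof. by move=> [C uC]; exists C => n; have := uC (f n); rewrite !expr1n. Qed.

Lemma norm_mulX_le (R : realType) (a q : R[i]) m : `|q| < 1 -> `|a * q ^+ m| <= `|a|.
Proof. by move=> q1; rewrite normrM normrX ler_piMr // exprn_ile1 // ltW. Qed.

(** A bound uniform in z: it controls all the factors 1 / (1 - a q^m). *)
Lemma norm_1subV_le (R : realType) (a z : R[i]) : `|a| < 1 -> `|z| <= `|a| ->
  `|(1 - z)^-1| <= (1 - `|a|)^-1.
Proof.
move=> a1 za; have a10 : 0 < 1 - `|a| by rewrite subr_gt0.
have le : 1 - `|a| <= `|1 - z|.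
  by apply: le_trans (lerB_dist _ _); rewrite normr1 lerD2l lerN2.
by rewrite normfV lef_pV2 // posrE (lt_le_trans a10).
Qed.

Lemma sub1_neq0 (R : realType) (z : R[i]) : `|z| < 1 -> 1 - z != 0.
Proof.
move=> z1; apply/eqP => /eqP; rewrite subr_eq0 => /eqP z1'.
by move: z1; rewrite -z1' normr1 ltxx.
Qed.

Lemma sub1X_neq0 (R : realType) (a q : R[i]) m :
  `|q| < 1 -> `|a| < 1 -> 1 - a * q ^+ m != 0.
Proof. by move=> q1 a1; rewrite sub1_neq0 // (le_lt_trans (norm_mulX_le _ _ q1)). Qed.

Lemma qpoch_bounded_cvg (R : realType) (a q : R[i]) : `|q| < 1 ->
  geo_dom 1 (qpoch a q) /\ cvgn (qpoch a q).
Proof.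
move=> /normc_lt1[r r01 qr].
apply: (geo_dom_prod (r := r) (x := fun m => - (a * q ^+ m))) => //.
rewrite -[r]mul1r; apply: geo_dom_le (geo_domM (geo_dom_cst a) (geo_dom_expr qr)) _.
by move=> n; rewrite normrN.
Qed.

(** The inverse is again an infinite product of the kind treated above, since
    1 / (1 - z) = 1 + z / (1 - z) with z = a q^m. *)
Lemma qpochV_bounded_cvg (R : realType) (a q : R[i]) : `|q| < 1 -> `|a| < 1 ->
  geo_dom 1 (fun n => (qpoch a q n)^-1) /\ cvgn (fun n => (qpoch a q n)^-1).
Proof.
move=> q1 a1; have [r r01 qr] := normc_lt1 q1.
have -> : (fun n => (qpoch a q n)^-1) =
    (fun n => \prod_(m < n) (1 + a * q ^+ m / (1 - a * q ^+ m))).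
  apply/funext => n; rewrite /qpoch -prodfV; apply: eq_bigr => m _.
  have nz := sub1X_neq0 m q1 a1.
  by rewrite -[LHS]mul1r -{1}(subrK (a * q ^+ m) 1) mulrDl divff.
apply: (geo_dom_prod (r := r) (x := fun m => a * q ^+ m / (1 - a * q ^+ m))) => //.
have -> : r = 1 * r * 1 by rewrite mul1r mulr1.
apply: geo_dom_le (geo_domM (geo_domM (geo_dom_cst a) (geo_dom_expr qr))
  (geo_dom_cst (1 - `|a|)^-1)) _ => m.
rewrite normrM [leRHS]normrM ler_wpM2l // [leRHS]ger0_norm.
  by apply: norm_1subV_le => //; exact: norm_mulX_le.
by rewrite invr_ge0 subr_ge0 ltW.
Qed.

Lemma cvg_qpoch (R : realType) (a q : R[i]) : `|q| < 1 ->
  qpoch a q @ \oo --> qpoch_oo a q.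
Proof. by move=> q1; have [] := qpoch_bounded_cvg a q1. Qed.

Lemma qpoch_neq0 (R : realType) (a q : R[i]) n : `|q| < 1 -> `|a| < 1 ->
  qpoch a q n != 0.
Proof. by move=> q1 a1; apply/prodf_neq0 => m _; exact: sub1X_neq0. Qed.

(** (a)_n and 1 / (a)_n both converge and their product is 1. *)
Lemma qpoch_oo_neq0 (R : realType) (a q : R[i]) : `|q| < 1 -> `|a| < 1 ->
  qpoch_oo a q != 0.
Proof.
move=> q1 a1; have [_ cV] := qpochV_bounded_cvg q1 a1.
have := cvgcM (cvg_qpoch (a := a) q1) cV.
have -> : (fun n => qpoch a q n * (qpoch a q n)^-1) = (fun=> 1).
  by apply/funext => n; rewrite divff // qpoch_neq0.
move=> /cvgc_unique /(_ (cvgc_cst 1)) H.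
by apply/eqP => H0; move: H; rewrite H0 mul0r => /eqP; rewrite eq_sym oner_eq0.
Qed.

Lemma qpoch0 (K : numFieldType) (a q : K) : qpoch a q 0 = 1.
Proof. exact: big_ord0. Qed.

Lemma qpochS (K : numFieldType) (a q : K) n :
  qpoch a q n.+1 = qpoch a q n * (1 - a * q ^+ n).
Proof. exact: big_ord_recr. Qed.

Lemma qpochD (K : numFieldType) (a q : K) m n :
  qpoch a q (m + n) = qpoch a q m * qpoch (a * q ^+ m) q n.
Proof.
rewrite /qpoch big_split_ord; congr (_ * _); apply: eq_bigr => i _ /=.
by rewrite exprD mulrA.
Qed.

Lemma cvgc_addn (R : realType) (u : nat -> R[i]) (a : R[i]) m :
  u @ \oo --> a -> (fun n => u (m + n)%N) @ \oo --> a.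
Proof.
elim: m => [//|m IH] /IH /cvgcS.
by have -> // : (fun n => u (m + n.+1)%N) = (fun n => u (m.+1 + n)%N);
   apply/funext => n; rewrite addnS addSn.
Qed.

Lemma qpoch_ooD (R : realType) (a q : R[i]) m : `|q| < 1 ->
  qpoch_oo a q = qpoch a q m * qpoch_oo (a * q ^+ m) q.
Proof.
move=> q1; have := cvgc_addn m (cvg_qpoch (a := a) q1).
have -> : (fun n => qpoch a q (m + n)) =
  (fun n => qpoch a q m * qpoch (a * q ^+ m) q n).
  by apply/funext => n; rewrite qpochD.
by move/cvgc_unique; apply; apply: cvgcMl; exact: cvg_qpoch.
Qed.

(** * The 1phi1 summation *)

(** The summand of the basic hypergeometric series 1phi1(a; ab; q, b). *)
Definition phi11_term (K : numFieldType) (q a b : K) (n : nat) : K :=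
  qpoch a q n * (- b) ^+ n * q ^+ 'C(n, 2) / (qpoch q q n * qpoch (a * b) q n).

(** The telescoping certificate: with t(b, n) the summand, the combination of
    t(b, n) and t(bq, n) is G(n+1) - G(n) for
    G(n) = - (1 - ab) (1 - q^n) t(b, n). *)
Lemma phi11_term_rec (K : numFieldType) (q a b : K) n :
  qpoch q q n.+1 != 0 -> qpoch (a * b) q n.+1 != 0 ->
  (1 - a * b) * phi11_term q a b n - (1 - b) * phi11_term q a (b * q) n =
  (1 - a * b) * ((1 - q ^+ n) * phi11_term q a b n
                 - (1 - q ^+ n.+1) * phi11_term q a b n.+1).
Proof.
move=> Q0 D0.
have Dq : (1 - a * b) * qpoch (a * (b * q)) q n
          = qpoch (a * b) q n * (1 - a * b * q ^+ n).
  by rewrite -qpochS -add1n qpochD qpochS qpoch0 mul1r expr0 expr1 mulr1 mulrA.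
move: Q0 D0; rewrite !qpochS !mulf_eq0 !negb_or -exprS => /andP[Q0 q0] /andP[D0 x0].
have ab0 : 1 - a * b != 0.
  apply/eqP => ab; move: Dq; rewrite ab mul0r => /esym /eqP.
  by rewrite mulf_eq0 (negbTE D0) (negbTE x0).
have -> : phi11_term q a (b * q) n = qpoch a q n * ((- b) ^+ n * q ^+ n)
    * q ^+ 'C(n, 2) * (1 - a * b)
    / (qpoch q q n * (qpoch (a * b) q n * (1 - a * b * q ^+ n))).
  rewrite /phi11_term -Dq -mulNr exprMn; field.
  rewrite Q0 ab0 /=.
  rewrite andbT; apply/eqP => D'0; move: Dq; rewrite D'0 mulr0 => /esym /eqP.
  by rewrite mulf_eq0 (negbTE D0) (negbTE x0).
rewrite /phi11_term !qpochS binS bin1 exprD [q ^+ n.+1]exprS [(- b) ^+ n.+1]exprS.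
rewrite exprS in q0; field.
by rewrite Q0 D0 x0 q0.
Qed.

Lemma phi11_partial_rec (K : numFieldType) (q a b : K) n :
  (forall m, qpoch q q m != 0) -> (forall m, qpoch (a * b) q m != 0) ->
  (1 - a * b) * series (phi11_term q a b) n
    - (1 - b) * series (phi11_term q a (b * q)) n
  = - ((1 - a * b) * ((1 - q ^+ n) * phi11_term q a b n)).
Proof.
move=> Q0 D0; elim: n => [|n IH].
  by rewrite /series /= !big_geq // !mulr0 expr0 !subrr mul0r mulr0 oppr0.
rewrite !seriesS !mulrDr opprD addrACA IH phi11_term_rec //.
by rewrite mulrBr [LHS]addrC addKr.
Qed.

(** The constant M does not depend on N; this uniformity is what allows the
    limit N -> oo to be taken under the summation sign. It holds because
    1 / (ab q^N)_n = (ab)_N / (ab)_(N+n), a product of two bounded sequences. *)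
Lemma phi11_term_bound (R : realType) (q a b : R[i]) (r : R) :
  `|q| < 1 -> `|a * b| < 1 ->
  exists M : R, 0 <= M /\ forall N n,
    `|phi11_term q a (b * q ^+ N) n| <= M%:C * (`|b| * `|q| ^+ N) ^+ n.
Proof.
move=> q1 ab1.
have [[A hA] _] := qpoch_bounded_cvg a q1.
have [[D hD] _] := qpoch_bounded_cvg (a * b) q1.
have [[Q hQ] _] := qpochV_bounded_cvg q1 q1.
have [[E hE] _] := qpochV_bounded_cvg q1 ab1.
have ge0 (u : nat -> R[i]) C : (forall n, `|u n| <= (C * 1 ^+ n)%:C) -> 0 <= C.
  by move=> /(_ 0); rewrite expr0 mulr1 -ler0c; exact: le_trans.
have [A0 D0 Q0 E0] := And4 (ge0 _ _ hA) (ge0 _ _ hD) (ge0 _ _ hQ) (ge0 _ _ hE).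
exists (A * Q * (D * E)); split; first by rewrite !mulr_ge0.
move=> N n.
have Dq0 := qpoch_neq0 N q1 ab1.
have -> : phi11_term q a (b * q ^+ N) n =
    qpoch a q n * (qpoch q q n)^-1
    * (qpoch (a * b) q N * (qpoch (a * b) q (N + n))^-1)
    * (- (b * q ^+ N)) ^+ n * q ^+ 'C(n, 2).
  rewrite /phi11_term qpochD [a * (b * _)]mulrA; field.
  rewrite Dq0 !qpoch_neq0 //.
  by rewrite (le_lt_trans (norm_mulX_le _ _ q1)).
rewrite normrM -[leRHS]mulr1 ler_pM //; last by rewrite normrX exprn_ile1 // ltW.
rewrite normrM normrX normrN [`|b * _|]normrM normrX ler_wpM2r ?exprn_ge0 ?mulr_ge0 ?exprn_ge0 //.
move: (hA n) (hQ n) (hD N) (hE (N + n)%N); rewrite !expr1n !mulr1 => *.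
by rewrite !normrM !rmorphM !ler_pM ?mulr_ge0.
Qed.

Lemma geo_dom_phi11_term (R : realType) (q a b : R[i]) (s : R) :
  `|q| < 1 -> `|a * b| < 1 -> `|b| = s%:C -> geo_dom s (phi11_term q a b).
Proof.
move=> q1 ab1 bs; have [M [_ MP]] := phi11_term_bound 0 q1 ab1; exists M => n.
by have := MP 0 n; rewrite !expr0 !mulr1 bs rmorphM rmorphXn.
Qed.

Lemma phi11_cvg (R : realType) (q a b : R[i]) :
  `|q| < 1 -> `|b| < 1 -> `|a * b| < 1 -> cvgn (series (phi11_term q a b)).
Proof.
move=> q1 b1 ab1; have [s s01 bs] := normc_lt1 b1.
exact: geo_dom_cvg_series s01 (geo_dom_phi11_term q1 ab1 bs).
Qed.

(** The summand of index 0 is 1, and by the uniform bound each of the others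
    carries a factor q^N. *)
Lemma phi11_lim1 (R : realType) (q a b : R[i]) :
  `|q| < 1 -> `|b| < 1 -> `|a * b| < 1 ->
  (fun N => limn (series (phi11_term q a (b * q ^+ N)))) @ \oo --> (1 : R[i]).
Proof.
move=> q1 b1 ab1.
have [r r01 qr] := normc_lt1 q1; have [s s01 bs] := normc_lt1 b1.
have /andP[r0 r1] := r01; have /andP[s0 s1] := s01.
have [M [M0 MP]] := phi11_term_bound 0 q1 ab1.
suff : geo_dom r (fun N => limn (series (phi11_term q a (b * q ^+ N))) - 1).
  move=> /(geo_dom_cvg0 r01) /cvgcD /(_ (cvgc_cst 1)); rewrite add0r.
  by have -> // : (fun N => limn (series (phi11_term q a (b * q ^+ N))) - 1 + 1)
    = (fun N => limn (series (phi11_term q a (b * q ^+ N)))) by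
    apply/funext => N; rewrite subrK.
exists (M * (1 - s)^-1) => N.
have cN : cvgn (series (phi11_term q a (b * q ^+ N))).
  apply: phi11_cvg => //; first exact: le_lt_trans (norm_mulX_le _ _ q1) b1.
  by rewrite mulrA (le_lt_trans (norm_mulX_le _ _ q1)).
apply: cvgc_norm_le (cvgcB (cvgcS cN) (cvgc_cst 1)) _ => n.
have -> : series (phi11_term q a (b * q ^+ N)) n.+1 - 1 =
    \sum_(k < n) phi11_term q a (b * q ^+ N) k.+1.
  rewrite /series /= big_nat_recl // big_mkord {1}/phi11_term !qpoch0 !expr0.
  by rewrite !mulr1 divff ?oner_eq0 // addrAC subrr add0r.
apply: le_trans (ler_norm_sum _ _ _) _.
apply: (@le_trans _ _ (\sum_(k < n) (M * r ^+ N * s ^+ k)%:C)).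
  apply: ler_sum => k _; apply: le_trans (MP N k.+1) _.
  rewrite bs qr -rmorphXn -rmorphM -rmorphXn -rmorphM lecR -mulrA ler_wpM2l //.
  rewrite exprMn mulrC ler_pM ?exprn_ge0 //.
    by rewrite exprS ler_piMr ?exprn_ge0 // exprn_ile1 ?exprn_ge0 // exprn_ile1 // ltW.
  by rewrite exprS ler_piMl ?exprn_ge0 // ltW.
rewrite -rmorph_sum lecR -mulr_sumr mulrAC ler_wpM2r ?exprn_ge0 //.
by rewrite ler_wpM2l // sum_expr_le.
Qed.

(** The q-analogue of a Gauss summation: iterate
    (1 - ab) phi(b) = (1 - b) phi(bq) and let b q^N tend to 0. *)
Lemma phi11_sum (R : realType) (q a b : R[i]) :
  `|q| < 1 -> `|b| < 1 -> `|a * b| < 1 ->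
  series (phi11_term q a b) @ \oo --> qpoch_oo b q / qpoch_oo (a * b) q.
Proof.
move=> q1 b1 ab1.
pose phi N : R[i] := limn (series (phi11_term q a (b * q ^+ N))).
have bN N : `|b * q ^+ N| < 1 by rewrite (le_lt_trans (norm_mulX_le _ _ q1)).
have abN N : `|a * (b * q ^+ N)| < 1.
  by rewrite mulrA (le_lt_trans (norm_mulX_le _ _ q1)).
have cphi N : series (phi11_term q a (b * q ^+ N)) @ \oo --> phi N.
  exact: phi11_cvg.
have phi1 : phi @ \oo --> (1 : R[i]) by exact: phi11_lim1.
(* From here on only the two limits matter, not the value of phi. *)
clearbody phi.
have rec N : (1 - a * b * q ^+ N) * phi N = (1 - b * q ^+ N) * phi N.+1.
  have cl := cvgcB (cvgcMl (1 - a * b * q ^+ N) (cphi N))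
                   (cvgcMl (1 - b * q ^+ N) (cphi N.+1)).
  apply/eqP; rewrite -subr_eq0; apply/eqP; apply: cvgc_unique cl _.
  have [s s01 bs] := normc_lt1 (bN N).
  apply: (geo_dom_cvg0 s01).
  (* The boundary term of the telescoping sum tends to 0; the factor 2 bounds
     |1 - q^n|. *)
  have dom := geo_domM (geo_dom_cst ((1 - a * (b * q ^+ N)) * 2))
                       (geo_dom_phi11_term q1 (abN N) bs).
  rewrite mul1r in dom; apply: geo_dom_le dom _ => n /=.
  rewrite exprSr [b * (_ * q)]mulrA -[a * b * _]mulrA phi11_partial_rec; last 2 first.
  - by move=> m; exact: qpoch_neq0.
  - by move=> m; exact: qpoch_neq0.
  rewrite normrN -[_ * 2 * _]mulrA normrM [leRHS]normrM ler_wpM2l //.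
  rewrite normrM [leRHS]normrM ler_wpM2r //.
  apply: le_trans (ler_normB _ _) _.
  by rewrite normr1 [leRHS]ger0_norm // lerD2l normrX exprn_ile1 // ltW.
have iter N : qpoch (a * b) q N * phi 0 = qpoch b q N * phi N.
  elim: N => [|N IH]; first by rewrite !qpoch0.
  by rewrite !qpochS mulrAC IH -[LHS]mulrA (mulrC (phi N)) rec [LHS]mulrA.
have l1 := cvgcM (cvg_qpoch (a := b) q1) phi1.
have l2 := cvgcM (cvg_qpoch (a := a * b) q1) (cvgc_cst (phi 0)).
have E : qpoch_oo (a * b) q * phi 0 = qpoch_oo b q * 1.
  apply: cvgc_unique l2 _.
  by have -> : (fun n => qpoch (a * b) q n * phi 0) = (fun n => qpoch b q n * phi n)
    by apply/funext.
have phi0E : phi 0 = qpoch_oo b q / qpoch_oo (a * b) q.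
  by apply: (canRL (mulfK (qpoch_oo_neq0 q1 ab1))); rewrite mulrC E mulr1.
by have := cphi 0; rewrite expr0 mulr1 phi0E.
Qed.

(** * The truncated theta identity *)

Definition theta_sum (K : fieldType) (q : K) (l : nat) : K :=
  \sum_(0 <= k < 2 * l)
    let j : int := k%:Z - l%:Z + 1 in (- 1) ^ j * q ^ (j ^+ 2).

(** The new terms are those with j = -l and j = l + 1. *)
Lemma theta_sumS (K : fieldType) (q : K) (l : nat) :
  theta_sum q l.+1 =
    theta_sum q l + (-1) ^+ l * (q ^+ (l ^ 2) * (1 - q ^+ (2 * l).+1)).
Proof.
rewrite /theta_sum mulnS big_nat_recr //= big_nat_recl //=.
have -> : (0%:Z - l.+1%:Z + 1 = - l%:Z)%R by lia.
have -> : ((2 * l).+1%:Z - l.+1%:Z + 1 = l.+1%:Z)%R by lia.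
under eq_bigr => k _ do have -> : (k.+1%:Z - l.+1%:Z + 1 = k%:Z - l%:Z + 1)%R by lia.
have sqZ (m : nat) : (m%:Z ^+ 2 = (m ^ 2)%N%:Z)%R by rewrite expr2 -PoszM mulnn.
rewrite sqrrN !sqZ -invr_expz -!exprnP invr_sign addrAC addrC; congr (_ + _).
rewrite mulrBr mulr1 -exprD mulrBr [(-1) ^+ l.+1]exprS mulN1r mulNr.
by have -> : (l.+1 ^ 2 = l ^ 2 + (2 * l).+1)%N by lia.
Qed.

Definition tail_term (K : numFieldType) (q : K) (l n : nat) : K :=
  qpoch (- q) q (n + l) * q ^+ (l * n + (n * n.+1) %/ 2 + l ^ 2) * (1 - q ^+ l)
    / (qpoch q q n * qpoch q q (n + 2 * l) * (1 - q ^+ (n + l))).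

(** What the summands of two consecutive tail series add up to, apart from a
    factor that does not depend on n; see [tail_term_glue]. *)
Definition glued_term (K : numFieldType) (q : K) (l n : nat) : K :=
  qpoch (- q) q (n + l) * q ^+ (l * n + 'C(n.+1, 2))
    / (qpoch q q n * qpoch q q (n + (2 * l).+1)).

(** With u = q^n and v = q^l this reduces to
    (1 - v) (1 - q^2 u v^2) + v (1 - q v) (1 - q u) = (1 - q u v) (1 - q v^2). *)
Lemma tail_term_glue (K : numFieldType) (q : K) l n :
  (forall m, qpoch q q m != 0) ->
  tail_term q l n.+1 + tail_term q l.+1 n
  = q ^+ (l ^ 2) * (1 - q ^+ (2 * l).+1) * glued_term q l n.+1.
Proof.
move=> Q0; rewrite /tail_term /glued_term.
have -> : (n.+1 + l = n + l.+1)%N by lia.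
have -> : (n.+1 + 2 * l = (n + 2 * l).+1)%N by lia.
have -> : (n.+1 + (2 * l).+1 = (n + 2 * l).+2)%N by lia.
have -> : (n + 2 * l.+1 = (n + 2 * l).+2)%N by lia.
have tri m : ((m * m.+1) %/ 2 = 'C(m.+1, 2))%N by rewrite bin2 divn2 mulnC.
rewrite !tri [in 'C(n.+2, 2)]binS bin1.
have q1 m : 1 - q ^+ m.+1 != 0.
  by have := Q0 m.+1; rewrite qpochS mulf_eq0 negb_or -exprS => /andP[].
have := q1 n; have := q1 (n + l)%N; have := q1 (n + 2 * l).+1.
have := Q0 n; have := Q0 (n + 2 * l).+1.
rewrite ![qpoch q q _.+2]qpochS [qpoch q q n.+1]qpochS.
set A := qpoch (- q) q _; set D := qpoch q q _.+1; set Q := qpoch q q n.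
rewrite -!exprS.
have -> : q ^+ (n + 2 * l).+2 = q ^+ 2 * q ^+ n * q ^+ l ^+ 2.
  by rewrite -!exprM -!exprD; congr (_ ^+ _); lia.
have -> : q ^+ (n + l.+1) = q * q ^+ n * q ^+ l.
  by rewrite -exprS -exprD; congr (_ ^+ _); lia.
have -> : q ^+ (n + l).+1 = q * q ^+ n * q ^+ l.
  by rewrite -exprS -exprD; congr (_ ^+ _); lia.
have -> : q ^+ (2 * l).+1 = q * q ^+ l ^+ 2.
  by rewrite -exprM -exprS; congr (_ ^+ _); lia.
have -> : q ^+ (l * n.+1 + ('C(n.+1, 2) + n.+1) + l ^ 2)
    = q ^+ (l * n + 'C(n.+1, 2)) * q ^+ l * (q * q ^+ n) * q ^+ (l ^ 2).
  by rewrite -exprS -!exprD; congr (_ ^+ _); lia.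
have -> : q ^+ (l.+1 * n + 'C(n.+1, 2) + l.+1 ^ 2)
    = q ^+ (l * n + 'C(n.+1, 2)) * (q * q ^+ n) * q ^+ l ^+ 2 * q ^+ (l ^ 2).
  by rewrite -exprS -exprM -!exprD; congr (_ ^+ _); lia.
have -> : q ^+ (l * n.+1 + ('C(n.+1, 2) + n.+1))
    = q ^+ (l * n + 'C(n.+1, 2)) * q ^+ l * (q * q ^+ n).
  by rewrite -exprS -!exprD; congr (_ ^+ _); lia.
rewrite [q ^+ n.+1]exprS [q ^+ l.+1]exprS.
move: (q ^+ n) (q ^+ l) (q ^+ (l ^ 2)) (q ^+ (l * n + _)) => u v w x.
move=> D0 Qn0 nz1 nz2 nz3; field.
by rewrite Qn0 D0 nz1 nz2 nz3.
Qed.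

(** The summand n = 0 of the series for l has no partner in the series for
    l + 1, and equals the glued summand on its own, up to the same factor. *)
Lemma tail_sum_glue (K : numFieldType) (q : K) l n :
  (forall m, qpoch q q m != 0) -> (0 < l)%N ->
  series (tail_term q l) n.+1 + series (tail_term q l.+1) n
  = q ^+ (l ^ 2) * (1 - q ^+ (2 * l).+1) * series (glued_term q l) n.+1.
Proof.
move=> Q0 l0; elim: n => [|n IH]; last first.
  rewrite seriesS [series (tail_term q l.+1) _]seriesS [series (glued_term q l) _]seriesS.
  by rewrite addrACA IH [RHS]mulrDr tail_term_glue.
have q1 m : qpoch q q m != 0 /\ 1 - q ^+ m.+1 != 0.
  by have := Q0 m.+1; rewrite qpochS mulf_eq0 negb_or -exprS => /andP.
rewrite /series /= !big_nat1 [X in _ + X]big_geq // addr0 /tail_term /glued_term.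
rewrite !muln0 mul0n div0n bin_small // !add0n !qpoch0 qpochS -exprS expr0.
have [_ ql] := q1 l.-1; rewrite prednK // in ql.
by have [D0 q2] := q1 (2 * l)%N; field; rewrite D0 ql q2.
Qed.

(** The case l = 0: every summand of index at least 1 in the series for l
    vanishes, and the summand 1 takes the place of that of index 0, which is
    the indeterminate 0 / 0. *)
Lemma tail_sum_glue0 (K : numFieldType) (q : K) n :
  (forall m, qpoch q q m != 0) ->
  1 + series (tail_term q 1) n = (1 - q) * series (glued_term q 0) n.+1.
Proof.
move=> Q0; elim: n => [|n IH].
  have := Q0 1%N.
  rewrite /series /= big_geq // big_nat1 addr0 /glued_term qpochS !qpoch0.
  rewrite muln0 bin_small // !expr0 !mulr1 !mul1r => q1.
  by rewrite divff.
rewrite [series (tail_term q 1) _]seriesS [series (glued_term q 0) _]seriesS.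
rewrite [LHS]addrCA IH [RHS]mulrDr; congr (_ + _).
have := tail_term_glue 0 n Q0; rewrite {1}/tail_term expr0 subrr mulr0 mul0r add0r.
by move=> ->; rewrite ?expr0 muln0 expr1 mul1r.
Qed.

(** Split (-q)_(n+l) and (q)_(n+2l+1) at l and at 2l + 1. *)
Lemma glued_termE (R : realType) (q : R[i]) l n : `|q| < 1 ->
  glued_term q l n = qpoch (- q) q l / qpoch q q (2 * l).+1
    * phi11_term q (- q ^+ l.+1) (- q ^+ l.+1) n.
Proof.
move=> q1; rewrite /glued_term /phi11_term [(n + l)%N]addnC [(n + (2 * l).+1)%N]addnC.
rewrite !qpochD opprK mulNr -exprS mulrNN -exprD -exprS -exprM.
have -> : (l.+1 + l.+1 = (2 * l).+2)%N by lia.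
rewrite binS bin1.
have -> : (l * n + ('C(n, 2) + n) = l.+1 * n + 'C(n, 2))%N by lia.
rewrite exprD !invfM; ring.
Qed.

(** The prefactors (-q)_l and (q)_(2l+1) complete (-q^(l+1))_oo and
    (q^(2l+2))_oo to full products, so that the sum does not depend on l. *)
Lemma glued_sum (R : realType) (q : R[i]) l : `|q| < 1 ->
  series (glued_term q l) @ \oo --> qpoch_oo (- q) q / qpoch_oo q q.
Proof.
move=> q1; have ql : `|- q ^+ l.+1| < 1.
  by rewrite normrN normrX exprn_ilt1.
have qql : `|- q ^+ l.+1 * - q ^+ l.+1| < 1.
  by rewrite normrM mulr_ilt1.
have -> : series (glued_term q l) = (fun n => qpoch (- q) q l / qpoch q q (2 * l).+1
    * series (phi11_term q (- q ^+ l.+1) (- q ^+ l.+1)) n).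
  apply/funext => n; rewrite /series /= mulr_sumr; apply: eq_bigr => k _.
  exact: glued_termE.
have -> : qpoch_oo (- q) q / qpoch_oo q q = qpoch (- q) q l / qpoch q q (2 * l).+1
    * (qpoch_oo (- q ^+ l.+1) q / qpoch_oo (- q ^+ l.+1 * - q ^+ l.+1) q).
  rewrite (qpoch_ooD (- q) l q1) (qpoch_ooD q (2 * l).+1 q1) invfM mulNr -!exprS.
  have -> : - q ^+ l.+1 * - q ^+ l.+1 = q ^+ (2 * l).+2.
    by rewrite mulrNN -exprD; congr (_ ^+ _); lia.
  exact: mulrACA.
exact: cvgcMl (phi11_sum q1 ql qql).
Qed.

(** All the factors are bounded except q^(l n + ...), which is dominated by q^n
    as l is positive. *)
Lemma tail_cvg (R : realType) (q : R[i]) l : `|q| < 1 -> (0 < l)%N ->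
  cvgn (series (tail_term q l)).
Proof.
move=> q1 l0; have [r r01 qr] := normc_lt1 q1.
apply: (geo_dom_cvg_series r01).
have [bA _] := qpoch_bounded_cvg (- q) q1.
have [bQ _] := qpochV_bounded_cvg q1 q1.
have bl : geo_dom 1 (fun n => (1 - q ^+ (n + l))^-1).
  apply: geo_dom_le (geo_dom_cst (1 - `|q|)^-1) _ => n /=.
  rewrite [leRHS]ger0_norm; last by rewrite invr_ge0 subr_ge0 ltW.
  apply: norm_1subV_le => //.
  by rewrite -(prednK l0) addnS exprS norm_mulX_le.
have dom := geo_domM (geo_domM (geo_domM (geo_domM (geo_domM
  (geo_dom_comp (addn^~ l) bA) (geo_dom_expr qr)) (geo_dom_cst (1 - q ^+ l)))
  bQ) (geo_dom_comp (addn^~ (2 * l)%N) bQ)) bl.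
rewrite !mulr1 mul1r in dom.
apply: geo_dom_le dom _ => n /=.
rewrite /tail_term !invfM !mulrA !normrM !ler_wpM2r //= ler_wpM2l //.
rewrite !normrX; apply: ler_wiXn2l => //; first exact: ltW.
by rewrite -addnA; apply: leq_trans (leq_addr _ _); rewrite leq_pmull.
Qed.

Lemma theta_tail (R : realType) (q : R[i]) l : `|q| < 1 ->
  qpoch_oo (- q) q / qpoch_oo q q * theta_sum q l.+1
  = 1 + (-1) ^+ l * limn (series (tail_term q l.+1)).
Proof.
move=> q1.
have Q0 m : qpoch q q m != 0 by exact: qpoch_neq0.
pose T m : R[i] := limn (series (tail_term q m.+1)).
have cT m : series (tail_term q m.+1) @ \oo --> T m by exact: tail_cvg.
have cG m := cvgcS (glued_sum m q1).
rewrite -/(T l); clearbody T.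
move: (qpoch_oo (- q) q / qpoch_oo q q) cG => P cG.
have T0 : 1 + T 0 = (1 - q) * P.
  apply: cvgc_unique (cvgcD (cvgc_cst 1) (cT 0)) _.
  have -> : (fun n => 1 + series (tail_term q 1) n)
    = (fun n => (1 - q) * series (glued_term q 0) n.+1).
    by apply/funext => n; exact: tail_sum_glue0.
  exact: cvgcMl (cG 0).
have TS m : T m + T m.+1 = q ^+ (m.+1 ^ 2) * (1 - q ^+ (2 * m.+1).+1) * P.
  apply: cvgc_unique (cvgcD (cvgcS (cT m)) (cT m.+1)) _.
  have -> : (fun n => series (tail_term q m.+1) n.+1 + series (tail_term q m.+2) n)
    = (fun n => q ^+ (m.+1 ^ 2) * (1 - q ^+ (2 * m.+1).+1)
                * series (glued_term q m.+1) n.+1).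
    by apply/funext => n; exact: tail_sum_glue.
  exact: cvgcMl (cG m.+1).
elim: l => [|l IH].
  rewrite theta_sumS /theta_sum muln0 big_geq // add0r expr0 !mul1r T0.
  by rewrite expr1 mulrC.
rewrite theta_sumS mulrDr IH.
have -> : P * ((-1) ^+ l.+1 * (q ^+ (l.+1 ^ 2) * (1 - q ^+ (2 * l.+1).+1)))
  = (-1) ^+ l.+1 * (T l + T l.+1) by rewrite TS [LHS]mulrC -[LHS]mulrA.
by rewrite exprS; ring.
Qed.

Theorem theorem1p5 (R : realType) (l : nat) (q : R[i]) (hl : (0 < l)%N)
    (hq : `|q| < 1) :
  let term := fun n : nat =>
    qpoch (- q) q (n + l) * q ^+ (l * n + (n * n.+1) %/ 2 + l ^ 2) * (1 - q ^+ l)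
      / (qpoch q q n * qpoch q q (n + 2 * l) * (1 - q ^+ (n + l))) in
  [/\ cvgn (qpoch (- q) q), cvgn (qpoch q q), cvgn (series term) &
      qpoch_oo (- q) q / qpoch_oo q q
        * (\sum_(0 <= k < 2 * l)
             let j : int := k%:Z - l%:Z + 1 in (- 1) ^ j * q ^ (j ^+ 2))
      = 1 + (- 1) ^+ (l - 1) * limn (series term)].
Proof.
move=> term; split.
- by have [] := qpoch_bounded_cvg (- q) hq.
- by have [] := qpoch_bounded_cvg q hq.
- exact: tail_cvg.
- by case: l hl @term => // l _; rewrite subn1; exact: theta_tail.
Qed.
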